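(* Let $u$ be a continuous function in a domain $\Omega\subset\mathbb{R}^N$ and let $1\le j\le N$. The asymptotic expansion $$u(x)=\min_{\dim(S)=j}\ \max_{v\in S,\,|v|=1}\left\{\tfrac12u(x+\epsilon v)+\tfrac12u(x-\epsilon v)\right\}+o(\epsilon^2),\qquad\text{as }\epsilon\to0,$$ holds in the viscosity sense in $\Omega$ if and only if $\lambda_j(D^2u)=0$ in $\Omega$ in the viscosity sense.
   Context: For a symmetric $N\times N$ matrix $X$, $\lambda_1(X)\le\dots\le\lambda_N(X)$ denote its eigenvalues in increasing order, counted with multiplicity. In $\min_{\dim(S)=j}$, $S$ ranges over linear subspaces of $\mathbb{R}^N$ of dimension $j$. The asymptotic expansion holds in the viscosity sense if: (1) for every $\phi\in C^2$ such that $u-\phi$ has a strict minimum at a point $x\in\Omega$ with $u(x)=\phi(x)$, $$0\ge-\phi(x)+\min_{\dim(S)=j}\max_{v\in S,|v|=1}\left\{\tfrac12\phi(x+\epsilon v)+\tfrac12\phi(x-\epsilon v)\right\}+o(\epsilon^2)\quad\text{as }\epsilon\to0;$$ (2) for every $\psi\in C^2$ such that $u-\psi$ has a strict maximum at a point $x\in\Omega$ with $u(x)=\psi(x)$, $$0\le-\psi(x)+\min_{\dim(S)=j}\max_{v\in S,|v|=1}\left\{\tfrac12\psi(x+\epsilon v)+\tfrac12\psi(x-\epsilon v)\right\}+o(\epsilon^2)\quad\text{as }\epsilon\to0.$$ Here each inequality means that it holds for all small $\epsilon>0$ with some error term $o(\epsilon^2)$, which may depend on the test function and on $x$. The equation $\lambda_j(D^2u)=0$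 holds in the viscosity sense if: (1) for every $\phi\in C^2$ such that $u-\phi$ has a strict minimum at a point $x\in\Omega$ with $u(x)=\phi(x)$, one has $\lambda_j(D^2\phi(x))\le0$; and (2) for every $\psi\in C^2$ such that $u-\psi$ has a strict maximum at a point $x\in\Omega$ with $u(x)=\psi(x)$, one has $\lambda_j(D^2\psi(x))\ge0$. *)

(* Defs.v *)
From HB Require Import structures.
From mathcomp Require Import all_boot all_order all_algebra.
From mathcomp Require Import all_classical all_reals all_analysis.

Set Implicit Arguments.
Unset Strict Implicit.
Unset Printing Implicit Defensive.

Import Order.TTheory GRing.Theory Num.Theory.
Import numFieldNormedType.Exports.

Local Open Scope classical_set_scope.
Local Open Scope ring_scope.

Definition domain (T : topologicalType) (Omega : set T) : Prop :=
  [/\ open Omega, connected Omega & Omega !=set0].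

(* The normed-space structure on 'rV[R]_N carries the sup norm, so the Euclidean
   length |v| has to be introduced separately. *)
Definition euclid_norm (R : realType) (N : nat) (v : 'rV[R]_N) : R :=
  Num.sqrt (\sum_i v 0 i ^+ 2).

(* Genuine maximum and minimum of a set of reals: the value belongs to the set.
   If it is not attained, the result is the junk value 0. *)
Definition max_set (R : realType) (A : set R) : R := xget 0 (A `&` ubound A).
Definition min_set (R : realType) (A : set R) : R := xget 0 (A `&` lbound A).

Definition mean_sym (R : realType) (N : nat) (f : 'rV[R]_N -> R)
    (x : 'rV[R]_N) (e : R) (v : 'rV[R]_N) : R :=
  2^-1 * f (x + e *: v) + 2^-1 * f (x - e *: v).

Definition minmax_mean (R : realType) (N j : nat) (f : 'rV[R]_N -> R)
    (x : 'rV[R]_N) (e : R) : R :=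
  min_set [set max_set [set mean_sym f x e v |
                         v in [set v | v \in S /\ euclid_norm v = 1]]
          | S in [set S : {vspace 'rV[R]_N} | \dim S = j]].

Definition partial (R : realType) (N : nat) (i : 'I_N) (f : 'rV[R]_N -> R)
    (x : 'rV[R]_N) : R :=
  'D_(delta_mx 0 i : 'rV[R]_N) f x.

Definition has_partial (R : realType) (N : nat) (i : 'I_N)
    (f : 'rV[R]_N -> R) (x : 'rV[R]_N) : Prop :=
  derivable f x (delta_mx 0 i : 'rV[R]_N).

(* Functions are total on 'rV[R]_N; for an open Omega only the values taken on
   Omega matter. *)
Definition C2_on (R : realType) (N : nat) (Omega : set 'rV[R]_N)
    (f : 'rV[R]_N -> R) : Prop :=
  [/\ {in Omega, continuous f},
      forall i, (forall x, Omega x -> has_partial i f x) /\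
                {in Omega, continuous (partial i f)}
    & forall i k, (forall x, Omega x -> has_partial k (partial i f) x) /\
                  {in Omega, continuous (partial k (partial i f))}].

Definition hessian (R : realType) (N : nat) (f : 'rV[R]_N -> R)
    (x : 'rV[R]_N) : 'M[R]_N :=
  \matrix_(i, k) partial i (partial k f) x.

(* The increasing list of the eigenvalues of X, each repeated according to its
   multiplicity as a root of the characteristic polynomial.  Such a list is
   unique, and it exists, with N entries, when X is symmetric; otherwise it may
   fail to exist and [::] is returned. *)
Definition eigenvalues (R : realType) (N : nat) (X : 'M[R]_N) : seq R :=
  xget [::] [set s : seq R | sorted <=%R s /\
                             char_poly X = \prod_(a <- s) ('X - a%:P)].

(* Eigenvalues are numbered from 1, list entries from 0. *)
Definition lambda (R : realType) (N j : nat) (X : 'M[R]_N) : R :=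
  nth 0 (eigenvalues X) j.-1.

Definition touches_below (R : realType) (N : nat) (Omega : set 'rV[R]_N)
    (u phi : 'rV[R]_N -> R) (x : 'rV[R]_N) : Prop :=
  [/\ Omega x, u x = phi x
    & forall y, Omega y -> y != x -> u x - phi x < u y - phi y].

Definition touches_above (R : realType) (N : nat) (Omega : set 'rV[R]_N)
    (u psi : 'rV[R]_N -> R) (x : 'rV[R]_N) : Prop :=
  [/\ Omega x, u x = psi x
    & forall y, Omega y -> y != x -> u y - psi y < u x - psi x].

Definition asymptotic_expansion_viscosity (R : realType) (N j : nat)
    (Omega : set 'rV[R]_N) (u : 'rV[R]_N -> R) : Prop :=
  (forall (phi : 'rV[R]_N -> R) (x : 'rV[R]_N),
     C2_on Omega phi -> touches_below Omega u phi x ->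
     exists2 r : R -> R, r =o_ (0^'+) (fun e : R => e ^+ 2)
       & \forall e \near 0^'+, 0 >= - phi x + minmax_mean j phi x e + r e) /\
  (forall (psi : 'rV[R]_N -> R) (x : 'rV[R]_N),
     C2_on Omega psi -> touches_above Omega u psi x ->
     exists2 r : R -> R, r =o_ (0^'+) (fun e : R => e ^+ 2)
       & \forall e \near 0^'+, 0 <= - psi x + minmax_mean j psi x e + r e).

Definition lambda_equation_viscosity (R : realType) (N j : nat)
    (Omega : set 'rV[R]_N) (u : 'rV[R]_N -> R) : Prop :=
  (forall (phi : 'rV[R]_N -> R) (x : 'rV[R]_N),
     C2_on Omega phi -> touches_below Omega u phi x ->
     lambda j (hessian phi x) <= 0) /\
  (forall (psi : 'rV[R]_N -> R) (x : 'rV[R]_N),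
     C2_on Omega psi -> touches_above Omega u psi x ->
     0 <= lambda j (hessian psi x)).

(* Main.v *)
Require Import Defs.
From HB Require Import structures.
From mathcomp Require Import all_boot all_order all_algebra.
From mathcomp Require Import all_classical all_reals all_analysis.
From mathcomp Require Import ring lra.
Import Order.TTheory GRing.Theory Num.Theory.
Import numFieldNormedType.Exports.
Local Open Scope classical_set_scope.
Local Open Scope ring_scope.

Set Implicit Arguments.
Unset Strict Implicit.
Unset Printing Implicit Defensive.

(* A test function f is C^2, so its first partials are differentiable at x, and
   uniformly over unit vectors v
     (f (x + e v) + f (x - e v)) / 2 = f x + e^2 / 2 <D^2 f(x) v, v> + o(e^2).
   Taking the maximum over the unit sphere of S and the minimum over S, the
   Courant-Fischer formula turns this into
     minmax_mean j f x e = f x + e^2 / 2 lambda_j(D^2 f(x)) + o(e^2),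
   so the sign conditions on both sides are the same.  Since max_set and min_set
   are 0 when the extremum is not attained, attainment has to be proved: the
   unit sphere and the set of orthonormal j-frames are compact. *)

(** * Dot product and orthonormal families *)

Lemma continuous_at_sum (R : realType) (V : normedModType R)
    (T : topologicalType) (I : Type) (r : seq I) (F : I -> T -> V) (x : T) :
  (forall i, continuous_at x (F i)) ->
  continuous_at x (fun y => \sum_(i <- r) F i y).
Proof.
move=> cF; elim: r => [|i r IH].
  by under eq_fun do rewrite big_nil; exact: cst_continuous.
under eq_fun do rewrite big_cons.
by apply: continuousD; [exact: cF|exact: IH].
Qed.

Definition dot (R : realType) (N : nat) (u v : 'rV[R]_N) : R :=
  (u *m v^T) 0 0.

Section DotProduct.
Variables (R : realType) (N : nat).
Implicit Types (u v w : 'rV[R]_N) (a : R) (H : 'M[R]_N).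

Lemma dotE u v : dot u v = \sum_i u 0 i * v 0 i.
Proof. by rewrite /dot mxE; apply: eq_bigr => i _; rewrite mxE. Qed.

Lemma dotC u v : dot u v = dot v u.
Proof. by rewrite !dotE; apply: eq_bigr => i _; rewrite mulrC. Qed.

Lemma dotDl u v w : dot (u + v) w = dot u w + dot v w.
Proof. by rewrite /dot mulmxDl mxE. Qed.

Lemma dotZl a u w : dot (a *: u) w = a * dot u w.
Proof. by rewrite /dot -scalemxAl mxE. Qed.

Lemma dotDr u v w : dot w (u + v) = dot w u + dot w v.
Proof. by rewrite !(dotC w) dotDl. Qed.

Lemma dotZr a u w : dot w (a *: u) = a * dot w u.
Proof. by rewrite !(dotC w) dotZl. Qed.

Lemma dot_suml (I : Type) (r : seq I) (P : pred I) (F : I -> 'rV[R]_N) w :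
  dot (\sum_(i <- r | P i) F i) w = \sum_(i <- r | P i) dot (F i) w.
Proof.
apply: (big_morph (fun u => dot u w)) => [u v|]; first exact: dotDl.
by rewrite /dot mul0mx mxE.
Qed.

Lemma dot_ge0 u : 0 <= dot u u.
Proof. by rewrite dotE; apply: sumr_ge0 => i _; rewrite -expr2 sqr_ge0. Qed.

Lemma dot_eq0 u : dot u u = 0 -> u = 0.
Proof.
rewrite dotE => /eqP; rewrite psumr_eq0 => [/allP u0|i _]; last first.
  by rewrite -expr2 sqr_ge0.
apply/rowP => i; rewrite mxE; have /eqP := u0 i (mem_index_enum i).
by move/eqP; rewrite mulf_eq0 orbb => /eqP.
Qed.

Lemma dot_sym H u v : H^T = H -> dot (u *m H) v = dot u (v *m H).
Proof. by move=> HT; rewrite /dot trmx_mul HT mulmxA. Qed.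

Lemma euclid_norm1 u : (euclid_norm u = 1) <-> (dot u u = 1).
Proof.
have -> : euclid_norm u = Num.sqrt (dot u u).
  by rewrite /euclid_norm dotE; under eq_bigr do rewrite expr2.
split=> [h|->]; last by rewrite sqrtr1.
by rewrite -(sqr_sqrtr (dot_ge0 u)) h expr1n.
Qed.

Lemma unit_coord_le1 u i : dot u u = 1 -> `|u 0 i| <= 1.
Proof.
move=> u1; rewrite -(@ler_pXn2r _ 2)// ?nnegrE// expr1n real_normK ?num_real//.
rewrite -u1 dotE (bigD1 i)//= -expr2 lerDl.
by apply: sumr_ge0 => k _; rewrite -expr2 sqr_ge0.
Qed.

Lemma norm_rV_le u a : 0 <= a -> (forall i, `|u 0 i| <= a) -> `|u| <= a.
Proof.
move=> a0 ua; rewrite [leLHS]/Num.norm/= mx_normrE.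
by apply/bigmax_leP; split=> // -[i l] _ /=; rewrite ord1.
Qed.

Lemma coord_le_norm u i : `|u 0 i| <= `|u|.
Proof.
rewrite [leRHS]/Num.norm/= mx_normrE.
by apply/bigmax_geP; right; exists (0, i).
Qed.

Lemma normalize u : u != 0 -> exists2 a, a != 0 & dot (a *: u) (a *: u) = 1.
Proof.
move=> u0; have dn : dot u u != 0 by apply: contra_neq u0 => /dot_eq0.
have dp : 0 < dot u u by rewrite lt_def dn dot_ge0.
exists (Num.sqrt (dot u u))^-1; first by rewrite invr_eq0 sqrtr_eq0 -ltNge.
rewrite dotZl dotZr mulrA -expr2 exprVn sqr_sqrtr ?dot_ge0//.
by rewrite mulVf.
Qed.

(** In coordinates over a basis of [S], the [k] orthogonality conditions form a matrix [M] with
    [\dim S] rows and only [k] columns. Its left kernel is therefore nonzero, and a nonzero element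
    gives [v] after normalization. *)
Lemma unit_orthogonal_in (S : {vspace 'rV[R]_N}) k (e : nat -> 'rV[R]_N) :
  (k < \dim S)%N ->
  exists v, [/\ v \in S, dot v v = 1 & forall i, (i < k)%N -> dot v (e i) = 0].
Proof.
move=> kS; pose b := vbasis S.
pose M : 'M[R]_(\dim S, k) := \matrix_(p, q) dot b`_p (e q).
have : kermx M != 0.
  rewrite kermx_eq0 /row_free; apply: contraL kS => /eqP <-.
  by rewrite -leqNgt rank_leq_col.
case/rowV0Pn => c /sub_kermxP cM c0.
pose v := \sum_p c 0 p *: b`_p.
have vS : v \in S.
  by apply: memv_suml => p _; apply/memvZ/vbasis_mem/mem_nth; rewrite size_tuple.
have v0 : v != 0.
  apply: contra_neq c0 => v0; apply/rowP => p; rewrite mxE.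
  have /freeP/(_ (fun p => c 0 p) v0 p) := basis_free (vbasisP S).
  exact.
have vo i : (i < k)%N -> dot v (e i) = 0.
  move=> ik; rewrite dot_suml.
  have /rowP/(_ (Ordinal ik)) := cM; rewrite !mxE; apply: etrans.
  by apply: eq_bigr => p _; rewrite mxE dotZl.
have [a _ a1] := normalize v0.
exists (a *: v); split=> //; first exact: memvZ.
by move=> i ik; rewrite dotZl vo// mulr0.
Qed.

(** Indexing by [nat] and constraining only the first [k] vectors lets a family be extended by
    overriding its value at [k]. *)
Definition orthonormal_upto k (e : nat -> 'rV[R]_N) :=
  forall i l, (i < k)%N -> (l < k)%N -> dot (e i) (e l) = (i == l)%:R.

Lemma orthonormalS k e v : orthonormal_upto k e -> dot v v = 1 ->
  (forall i, (i < k)%N -> dot v (e i) = 0) ->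
  orthonormal_upto k.+1 (fun i => if (i == k)%N then v else e i).
Proof.
move=> oe v1 vo i l; rewrite !ltnS => ik lk.
have [ei|nik] := eqVneq i k; have [el|nlk] := eqVneq l k.
- by rewrite ei el v1 eqxx.
- by rewrite ei eq_sym (negPf nlk) vo// ltn_neqAle nlk.
- by rewrite el (negPf nik) dotC vo// ltn_neqAle nik.
- by rewrite oe// ltn_neqAle ?nik ?nlk.
Qed.

Lemma orthonormal_family_in (S : {vspace 'rV[R]_N}) k : (k <= \dim S)%N ->
  exists2 e, orthonormal_upto k e & forall i, (i < k)%N -> e i \in S.
Proof.
elim: k => [_|k IH kS]; first by exists (fun=> 0).
have [e oe eS] := IH (ltnW kS).
have [v [vS v1 vo]] := unit_orthogonal_in e kS.
exists (fun i => if (i == k)%N then v else e i); first exact: orthonormalS.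
move=> i; rewrite ltnS leq_eqVlt.
by have [|_ /=] := eqVneq i k; [|exact: eS].
Qed.

Lemma dot_comb k e (c d : nat -> R) : orthonormal_upto k e ->
  dot (\sum_(i < k) c i *: e i) (\sum_(i < k) d i *: e i) =
  \sum_(i < k) c i * d i.
Proof.
move=> oe; rewrite dot_suml; apply: eq_bigr => i _.
rewrite dotZl dotC dot_suml (bigD1 i)//= dotZl oe// eqxx mulr1 big1 ?addr0//.
by move=> l li; rewrite dotZl oe// (inj_eq val_inj) (negPf li) mulr0.
Qed.

Lemma orthonormal_span k e : orthonormal_upto k e ->
  exists S : {vspace 'rV[R]_N}, \dim S = k /\
   forall v, v \in S <-> exists c : 'rV[R]_k, v = \sum_(i < k) c 0 i *: e i.
Proof.
move=> oe; pose X := [tuple e i | i < k].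
have Xi (i : 'I_k) : X`_i = e i by rewrite -tnth_nth tnth_mktuple.
have fX : free X.
  apply/freeP => c; under eq_bigr do rewrite Xi.
  move=> s0 i.
  have := congr1 (fun u => dot u (e i)) s0; rewrite dot_suml /=.
  rewrite (bigD1 i)//= dotZl oe// eqxx mulr1 big1 ?addr0.
    by rewrite /dot mul0mx mxE.
  by move=> l li; rewrite dotZl oe// (inj_eq val_inj) (negPf li) mulr0.
exists <<X>>%VS; split; first by move: fX; rewrite /free size_tuple => /eqP.
move=> v; split=> [vX|[c ->]].
  exists (\row_i coord X i v); rewrite {1}(coord_span vX).
  by apply: eq_bigr => i _; rewrite mxE Xi.
apply: memv_suml => i _; apply/memvZ/memv_span; rewrite -Xi.
by apply: mem_nth; rewrite size_tuple.
Qed.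

(** The span of the family lies in [S] and has the same dimension, so it equals [S]. *)
Lemma orthonormal_spans (S : {vspace 'rV[R]_N}) k e : \dim S = k ->
  orthonormal_upto k e -> (forall i, (i < k)%N -> e i \in S) ->
  forall v, v \in S <-> exists c : 'rV[R]_k, v = \sum_(i < k) c 0 i *: e i.
Proof.
move=> dS oe eS; have [T [dT memT]] := orthonormal_span oe.
suff TS : T = S by move=> v; rewrite -(memT v) TS.
apply/eqP; rewrite eqEdim dT dS leqnn andbT.
apply/subvP => v /memT[c ->].
by apply: memv_suml => i _; apply/memvZ/eS.
Qed.

Lemma continuous_at_dot (T : topologicalType) (f g : T -> 'rV[R]_N) x :
  continuous_at x f -> continuous_at x g ->
  continuous_at x (fun y => dot (f y) (g y)).
Proof.
move=> fx gx; under eq_fun do rewrite dotE.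
apply: continuous_at_sum => i; apply: continuousM.
  have := @continuous_comp _ _ _ f (fun w : 'rV[R]_N => w 0 i) x fx; apply.
  exact: coord_continuous.
have := @continuous_comp _ _ _ g (fun w : 'rV[R]_N => w 0 i) x gx; apply.
exact: coord_continuous.
Qed.

Lemma unit_sphere_compact : compact [set v : 'rV[R]_N | dot v v = 1].
Proof.
apply: (@bounded_closed_compact R N).
  (* The ambient norm is the sup norm, so boundedness reduces to the coordinates of a Euclidean unit
     vector being at most 1. *)
  exists 1; split; first exact: num_real.
  move=> M M1 v /= v1; apply: le_trans (ltW M1).
  by apply: norm_rV_le => // i; exact: unit_coord_le1.
have -> : [set v : 'rV[R]_N | dot v v = 1] =
    (fun v => dot v v) @^-1` [set 1] by [].
apply: (@preimage_closed _ R) (@closed_eq R 1).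
by move=> v _; apply: (@continuous_at_dot _ id id); exact: cvg_id.
Qed.

End DotProduct.

(** * Spectral theorem and the Courant-Fischer formula *)

(** First-order condition at the minimum [t = 0]. With [A = |a| + 1], the value at [t = - b / A] is
    [(b / A) ^+ 2 * (a - 2 * A)], whose second factor is negative, so [b / A] must vanish. *)
Lemma linear_coef_eq0 (R : realFieldType) (a b : R) :
  (forall t, 0 <= 2 * t * b + t ^+ 2 * a) -> b = 0.
Proof.
move=> h; pose A := `|a| + 1.
have A0 : 0 < A by rewrite ltr_wpDl.
have aA : a <= A by rewrite (le_trans (ler_norm a))// lerDl.
have := h (- b / A).
have -> : 2 * (- b / A) * b + (- b / A) ^+ 2 * a =
          (b / A) ^+ 2 * (a - 2 * A) by field; rewrite gt_eqF.
move=> h2; have : (b / A) ^+ 2 <= 0.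
  have : a - 2 * A < 0 by lra.
  by move=> /nmulr_lge0 <-.
rewrite le_eqVlt ltNge sqr_ge0 orbF sqrf_eq0 mulf_eq0 invr_eq0 (gt_eqF A0).
by rewrite orbF => /eqP.
Qed.

Section Spectral.
Variables (R : realType) (N : nat) (H : 'M[R]_N).
Hypothesis HT : H^T = H.

(* Rayleigh quotients: the next eigenvector minimizes the quadratic form on the
   unit vectors orthogonal to the previous ones. *)
Lemma rayleigh_minimizer k (e : nat -> 'rV[R]_N) : (k < N)%N ->
  exists v, [/\ dot v v = 1, forall i, (i < k)%N -> dot v (e i) = 0 &
    forall w, (forall i, (i < k)%N -> dot w (e i) = 0) ->
      dot (v *m H) v * dot w w <= dot (w *m H) w].
Proof.
move=> kN; pose A : set 'rV[R]_N :=
  [set v | dot v v = 1 /\ forall i, (i < k)%N -> dot v (e i) = 0].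
have A0 : A !=set0.
  have [|v [_ v1 vo]] := @unit_orthogonal_in R N fullv k e; last by exists v.
  by rewrite dimvf /dim/= mul1n.
have cA : compact A.
  have -> : A = [set v | dot v v = 1] `&`
      \bigcap_(i in [set i | (i < k)%N]) [set v | dot v (e i) = 0].
    by apply/seteqP; split=> v [].
  apply: compact_closedI; first exact: unit_sphere_compact.
  apply: closed_bigI => i _.
  apply: (@preimage_closed _ R (fun v => dot v (e i))) (@closed_eq R 0).
  move=> v _; apply: (@continuous_at_dot _ _ _ id (fun=> e i)).
    exact: cvg_id.
  exact: cst_continuous.
have cq : continuous (fun v : 'rV[R]_N => dot (v *m H) v).
  move=> v; apply: (@continuous_at_dot _ _ _ (fun w : 'rV[R]_N => w *m H) id).
    under eq_fun do rewrite mulmx_sum_row.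
    apply: continuous_at_sum => i; apply: continuousZr_tmp.
    exact: coord_continuous.
  exact: cvg_id.
have [v /set_mem[v1 vo] vmin] := compact_EVT_min A0 cA (continuous_subspaceT cq).
exists v; split=> // w wo.
(* Both sides are homogeneous of degree two in [w], so a nonzero [w] may be rescaled to the unit
   sphere, where minimality applies. *)
have [->|w0] := eqVneq w 0; first by rewrite /dot !mul0mx !mxE mulr0.
have [a a0 a1] := normalize w0.
have /vmin : a *: w \in A.
  by apply/mem_set; split=> // i ik; rewrite dotZl wo// mulr0.
rewrite -scalemxAl !dotZl !dotZr !mulrA -expr2.
have a2 : 0 < a ^+ 2 by rewrite exprn_even_gt0.
move: a1; rewrite !dotZl !dotZr mulrA -expr2.
move=> /(canRL (mulKf (lt0r_neq0 a2))) ->.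
by rewrite mulr1 ler_pdivrMr// mulrC.
Qed.

(** The residual [w = v *m H - m *: v] is orthogonal to the earlier eigenvectors because [H] is
    symmetric. So [v + t *: w] is admissible for every [t], and minimality at [t = 0] makes the
    linear coefficient, which is [dot w w], vanish. *)
Lemma rayleigh_eigenvector k (e : nat -> 'rV[R]_N) (d : nat -> R) v :
  (forall i, (i < k)%N -> e i *m H = d i *: e i) ->
  dot v v = 1 -> (forall i, (i < k)%N -> dot v (e i) = 0) ->
  (forall w, (forall i, (i < k)%N -> dot w (e i) = 0) ->
      dot (v *m H) v * dot w w <= dot (w *m H) w) ->
  v *m H = dot (v *m H) v *: v.
Proof.
move=> eH v1 vo vmin; set m := dot (v *m H) v; rewrite -/m in vmin.
pose w := v *m H + (- m) *: v.
have wo i : (i < k)%N -> dot w (e i) = 0.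
  move=> ik; rewrite dotDl dotZl vo// dot_sym// eH// dotZr vo//.
  by rewrite !mulr0 addr0.
suff /dot_eq0 : dot w w = 0.
  by rewrite /w scaleNr => /eqP; rewrite subr_eq0 => /eqP.
apply: (@linear_coef_eq0 R (dot (w *m H) w - m * dot w w)) => t.
have := vmin (v + t *: w); rewrite -subr_ge0 => /(_ _)/le_trans; apply.
  by move=> i ik; rewrite dotDl dotZl vo// wo// mulr0 addr0.
have : dot w w = dot (v *m H) w - m * dot v w.
  by rewrite {1}/w dotDl dotZl mulNr.
clearbody w => ww.
rewrite mulmxDl -scalemxAl !(dotDl, dotDr, dotZl, dotZr) -/m v1.
rewrite (dot_sym w v HT) (dotC w (v *m H)) (dotC w v).
rewrite le_eqVlt; apply/orP; left; apply/eqP.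
by rewrite [X in _ = 2 * t * X + _]ww; ring.
Qed.

(** Successive Rayleigh minimizers diagonalize [H]. The last clause records the minimality of each
    [d i]; it yields both the ordering of the eigenvalues and the lower bound in Courant-Fischer. *)
Lemma spectral : exists (e : nat -> 'rV[R]_N) (d : nat -> R),
  [/\ orthonormal_upto N e, forall i, (i < N)%N -> e i *m H = d i *: e i
    & forall i w, (i < N)%N -> (forall l, (l < i)%N -> dot w (e l) = 0) ->
        d i * dot w w <= dot (w *m H) w].
Proof.
suff: forall k, (k <= N)%N -> exists (e : nat -> 'rV[R]_N) (d : nat -> R),
  [/\ orthonormal_upto k e, forall i, (i < k)%N -> e i *m H = d i *: e i
    & forall i w, (i < k)%N -> (forall l, (l < i)%N -> dot w (e l) = 0) ->
        d i * dot w w <= dot (w *m H) w] by exact.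
elim=> [_|k IH kN]; first by exists (fun=> 0), (fun=> 0).
have [e [d [oe eH dmin]]] := IH (ltnW kN).
have [v [v1 vo vmin]] := rayleigh_minimizer e kN.
have vH := rayleigh_eigenvector eH v1 vo vmin.
exists (fun i => if (i == k)%N then v else e i).
exists (fun i => if (i == k)%N then dot (v *m H) v else d i).
split; first exact: orthonormalS.
- move=> i; rewrite ltnS leq_eqVlt.
  by have [|_ /=] := eqVneq i k; [|exact: eH].
- move=> i w; rewrite ltnS leq_eqVlt => ik wo.
  have {}wo l : (l < i)%N -> dot w (e l) = 0.
    move=> li; have := wo l li; rewrite ltn_eqF// (leq_trans li)//.
    by case/orP: ik => [/eqP->|/ltnW].
  have [ei|nik] := eqVneq i k; first by apply: vmin; rewrite -ei.
  by apply: dmin => //; move: ik; rewrite (negPf nik).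
Qed.

(** The matrix [P] with rows [e i] satisfies [P *m H = D *m P], so cancelling [\det P] gives the
    factorization of [char_poly H]. A factorization into linear factors is unique up to permutation
    and two sorted permutations coincide, so the choice made by [xget] is this list. *)
Lemma eigenvaluesP (e : nat -> 'rV[R]_N) (d : nat -> R) :
  orthonormal_upto N e -> (forall i, (i < N)%N -> e i *m H = d i *: e i) ->
  (forall i l, (i <= l < N)%N -> d i <= d l) ->
  eigenvalues H = mkseq d N.
Proof.
move=> oe eH dle.
have sd : sorted <=%R (mkseq d N).
  apply: (@path.homo_sorted_in _ _ (fun i => (i < N)%N) d leq <=%R).
  - by move=> i l _ lN il; apply: dle; rewrite il.
  - by apply/allP => i; rewrite mem_iota.
  - exact: iota_sorted.
have cd : char_poly H = \prod_(a <- mkseq d N) ('X - a%:P).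
  pose P : 'M[R]_N := \matrix_i e i.
  pose D : 'M[R]_N := diag_mx (\row_i d i).
  have PP : P *m P^T = 1%:M.
    apply/matrixP => i l.
    transitivity (dot (e i) (e l)); last by rewrite oe// mxE.
    rewrite dotE mxE.
    by apply: eq_bigr => p _; rewrite !mxE.
  have PH : P *m H = D *m P.
    apply/row_matrixP => i; rewrite row_mul rowK eH//.
    rewrite /D mul_diag_mx; apply/rowP => l; rewrite !mxE.
    by [].
  have cPD : map_mx polyC P *m char_poly_mx H = char_poly_mx D *m map_mx polyC P.
    by rewrite /char_poly_mx mulmxBr mulmxBl -!map_mxM PH mul_mx_scalar
      mul_scalar_mx.
  have dP : \det (map_mx polyC P) != 0.
    have := congr1 determinant PP; rewrite det_mulmx det_tr det1 det_map_mx.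
    rewrite polyC_eq0 => /eqP; apply: contraTneq => ->.
    by rewrite mul0r eq_sym oner_eq0.
  have : char_poly H = char_poly D.
    have := congr1 determinant cPD; rewrite !det_mulmx mulrC.
    exact: mulIf.
  move->; rewrite char_poly_trig ?diag_mx_is_trig//.
  rewrite /mkseq -val_enum_ord -map_comp big_map big_enum.
  by apply: eq_bigr => i _; rewrite !mxE eqxx.
rewrite /eigenvalues; case: xgetP => [s _ [ss cs]|/(_ (mkseq d N))[]//].
apply: (sorted_eq le_trans le_anti) ss sd _.
by apply: prod_XsubC_eq; rewrite -cs -cd.
Qed.

(** The span of the first [j] eigenvectors gives the upper bound. Any [S] of dimension [j] contains
    a unit vector orthogonal to the first [j - 1] eigenvectors, and there the quadratic form is at
    least the [j]-th eigenvalue. *)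
Lemma courant_fischer j : (1 <= j <= N)%N ->
  (exists S : {vspace 'rV[R]_N}, \dim S = j /\
     forall v, v \in S -> dot v v = 1 -> dot (v *m H) v <= lambda j H) /\
  (forall S : {vspace 'rV[R]_N}, \dim S = j ->
     exists v, [/\ v \in S, dot v v = 1 & lambda j H <= dot (v *m H) v]).
Proof.
(* From here [j] is the zero-based index: the subspaces have dimension [j.+1] and the eigenvalue is
   [d j]. *)
case: j => // j /= jN.
have [e [d [oe eH dmin]]] := spectral.
have dle i l : (i <= l < N)%N -> d i <= d l.
  move=> /andP[il lN].
  have := dmin i (e l) (leq_ltn_trans il lN).
  rewrite eH// dotZl oe// eqxx !mulr1; apply => p pi.
  have pl := leq_trans pi il.
  by rewrite oe ?gtn_eqF// (ltn_trans pl lN).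
have -> : lambda j.+1 H = d j.
  by rewrite /lambda (eigenvaluesP oe eH dle) nth_mkseq.
split; last first.
  move=> S dS; have [|v [vS v1 vo]] := @unit_orthogonal_in R N S j e.
    by rewrite dS.
  by exists v; split=> //; have := dmin j v jN vo; rewrite v1 mulr1.
have oej : orthonormal_upto j.+1 e.
  by move=> i l ij lj; apply: oe; [exact: leq_trans ij jN|exact: leq_trans lj jN].
have [S [dS memS]] := orthonormal_span oej.
exists S; split=> // v /memS[c ->].
pose c' i := c 0 (inord i).
have cc' (i : 'I_j.+1) : c 0 i = c' i by rewrite /c' inord_val.
under eq_bigr do rewrite cc'.
rewrite dot_comb// => c1.
have -> : (\sum_(i < j.+1) c' i *: e i) *m H =
    \sum_(i < j.+1) (c' i * d i) *: e i.
  rewrite mulmx_suml; apply: eq_bigr => i _.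
  by rewrite -scalemxAl eH ?scalerA// (leq_trans (ltn_ord i)).
rewrite (@dot_comb _ _ _ _ (fun i => c' i * d i))// -[leRHS]mulr1 -c1 mulr_sumr.
apply: ler_sum => i _; rewrite mulrAC mulrC ler_wpM2r -?expr2 ?sqr_ge0//.
by apply: dle; rewrite -ltnS ltn_ord.
Qed.
End Spectral.

(** * Attainment of the min-max *)

Lemma max_setE (R : realType) (A : set R) a :
  A a -> ubound A a -> max_set A = a.
Proof.
move=> Aa ua; rewrite /max_set; case: xgetP => [b _ [Ab ub]|/(_ a)]; last by case.
by apply/eqP; rewrite eq_le ua// ub.
Qed.

Lemma min_setE (R : realType) (A : set R) a :
  A a -> lbound A a -> min_set A = a.
Proof.
move=> Aa la; rewrite /min_set; case: xgetP => [b _ [Ab lb]|/(_ a)]; last by case.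
by apply/eqP; rewrite eq_le la// lb.
Qed.

(** Stated for entries in any topological space, since a frame is a row whose entries are themselves
    vectors. The witnessing neighbourhood constrains only the entry [(i, k)]. *)
Lemma entry_continuous (T : topologicalType) m n (i : 'I_m) (k : 'I_n) :
  continuous (fun M : 'M[T]_(m, n) => M i k).
Proof.
move=> M A MA; exists (fun p q => [set t | (p, q) = (i, k) -> A t]).
  move=> p q; have [pq|npq] := pselect ((p, q) = (i, k)).
    by case: (pq) => -> ->; apply: filterS MA => t At _.
  by apply: filterS (@filterT _ _ _) => t _ /npq.
by move=> Q /(_ i k)/= QA; exact: QA.
Qed.

Section MinMax.
Variables (R : realType) (N j : nat) (g : 'rV[R]_N -> R).
Hypothesis g_cont : forall v, dot v v = 1 -> continuous_at v g.
Implicit Types (F : 'rV['rV[R]_N]_j) (c : 'rV[R]_j).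

Definition comb F c : 'rV[R]_N := \sum_i c 0 i *: F 0 i.

(** A compact set parametrizing the [j]-dimensional subspaces through their orthonormal bases; a row
    of vectors carries the product topology. *)
Definition orthonormal_frames : set 'rV['rV[R]_N]_j :=
  [set F | forall i k, dot (F 0 i) (F 0 k) = (i == k)%:R].

Lemma comb_unit F c : orthonormal_frames F -> dot (comb F c) (comb F c) = dot c c.
Proof.
move=> oF; rewrite dot_suml dotE; apply: eq_bigr => i _.
rewrite dotZl dotC dot_suml (bigD1 i)//= dotZl oF eqxx mulr1 big1 ?addr0//.
by move=> l li; rewrite dotZl oF (negPf li) mulr0.
Qed.

Lemma frame_of_subspace (S : {vspace 'rV[R]_N}) : \dim S = j ->
  exists2 F, orthonormal_frames F &
    forall v, v \in S <-> exists c, v = comb F c.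
Proof.
move=> dS; have [|e oe eS] := @orthonormal_family_in R N S j.
  by rewrite dS.
exists (\row_i e i) => [i k|v]; first by rewrite !mxE oe.
rewrite (orthonormal_spans dS oe eS v).
by split=> -[c ->]; exists c; apply: eq_bigr => i _; rewrite mxE.
Qed.

Lemma subspace_of_frame F : orthonormal_frames F ->
  exists2 S : {vspace 'rV[R]_N}, \dim S = j &
    forall v, v \in S <-> exists c, v = comb F c.
Proof.
move=> oF; pose e n := if insub n is Some i then F 0 i else 0.
have eF (i : 'I_j) : e i = F 0 i by rewrite /e valK.
have oe : orthonormal_upto j e.
  by move=> i l ij lj; rewrite (eF (Ordinal ij)) (eF (Ordinal lj)) oF.
have [S [dS memS]] := orthonormal_span oe.
exists S => // v; rewrite memS.
by split=> -[c ->]; exists c; apply: eq_bigr => i _; rewrite eF.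
Qed.

(** The orthonormality equations are closed conditions inside a product of [j] unit spheres, which
    is compact. *)
Lemma orthonormal_frames_compact : compact orthonormal_frames.
Proof.
have cA := @rV_compact _ j (fun=> [set v : 'rV[R]_N | dot v v = 1])
  (fun=> @unit_sphere_compact R N).
apply: (subclosed_compact _ cA) => [|F oF i /=]; last by rewrite oF eqxx.
have -> : orthonormal_frames = \bigcap_(p in [set: 'I_j * 'I_j])
    [set F | dot (F 0 p.1) (F 0 p.2) = (p.1 == p.2)%:R].
  apply/seteqP; split=> F h; first by case=> i k _; exact: h.
  by move=> i k; exact: (h (i, k)).
apply: closed_bigI => -[i k] _ /=.
apply: (@preimage_closed _ R (fun F : 'rV['rV[R]_N]_j => dot (F 0 i) (F 0 k)))
  (@closed_eq R _) => F _.
by apply: (@continuous_at_dot _ _ _ (fun F : 'rV['rV[R]_N]_j => F 0 i)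
  (fun F : 'rV['rV[R]_N]_j => F 0 k)); exact: entry_continuous.
Qed.

Lemma comb_continuous_frame c : continuous (comb ^~ c).
Proof.
move=> F; apply: continuous_at_sum => i.
have := @continuous_comp _ _ _ (fun F : 'rV['rV[R]_N]_j => F 0 i)
  (fun w => c 0 i *: w) F; apply; first exact: entry_continuous.
exact: scaler_continuous.
Qed.

Lemma comb_continuous F : continuous (comb F).
Proof.
move=> c; apply: continuous_at_sum => i; apply: continuousZr_tmp.
exact: coord_continuous.
Qed.

Definition max_on (S : {vspace 'rV[R]_N}) : R :=
  max_set [set g v | v in [set v | v \in S /\ euclid_norm v = 1]].

(** An orthonormal frame maps the unit sphere of coefficients onto the unit sphere of [S], so the
    extreme value theorem applies in coordinates. Positivity of [j] makes that sphere nonempty. *)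
Lemma max_onP (S : {vspace 'rV[R]_N}) : (0 < j)%N -> \dim S = j ->
  (exists v, [/\ v \in S, dot v v = 1 & max_on S = g v]) /\
  (forall v, v \in S -> dot v v = 1 -> g v <= max_on S).
Proof.
move=> j0 dS; have [F oF memS] := frame_of_subspace dS.
have s0 : [set c : 'rV[R]_j | dot c c = 1] !=set0.
  have [|c [_ c1 _]] := @unit_orthogonal_in R j fullv 0 (fun=> 0).
  - by rewrite dimvf /dim/= mul1n.
  - by exists c.
have cg : {within [set c : 'rV[R]_j | dot c c = 1], continuous (g \o comb F)}.
  apply: continuous_in_subspaceT => c /set_mem/= c1.
  apply: continuous_comp; first exact: comb_continuous.
  by apply: g_cont; rewrite comb_unit.
have [c /set_mem/= c1 cmax] := compact_EVT_max s0 (@unit_sphere_compact R j) cg.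
have cS : comb F c \in S by apply/memS; exists c.
have ub v : v \in S -> dot v v = 1 -> g v <= g (comb F c).
  by move=> /memS[b ->]; rewrite comb_unit// => b1; apply: cmax; exact/mem_set.
have -> : max_on S = g (comb F c).
  apply: max_setE.
    by exists (comb F c) => //; split=> //; apply/euclid_norm1; rewrite comb_unit.
  by move=> _ [v [vS /euclid_norm1 v1] <-]; exact: ub.
by split=> //; exists (comb F c); rewrite comb_unit.
Qed.

(* The maximum over the unit sphere of the span is a supremum of continuous
   functions of the frame, so its sublevel sets are closed in the compact set of
   orthonormal frames, and being nested they have a common point. *)
Lemma min_max_attained : (0 < j <= N)%N ->
  exists2 S, \dim S = j & forall T, \dim T = j -> max_on S <= max_on T.
Proof.
move=> /andP[j0 jN].
pose D : set {vspace 'rV[R]_N} := [set S | \dim S = j].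
pose B (S : {vspace 'rV[R]_N}) : set 'rV['rV[R]_N]_j := orthonormal_frames `&`
  [set F | forall c, dot c c = 1 -> g (comb F c) <= max_on S].
have D0 : exists S, D S.
  have [|e oe _] := @orthonormal_family_in R N fullv j.
    by rewrite dimvf /dim/= mul1n.
  by have [S [dS _]] := orthonormal_span oe; exists S.
have BS S : D S -> B S !=set0.
  move=> dS; have [F oF memS] := frame_of_subspace dS.
  exists F; split=> // c c1; have [_] := max_onP j0 dS; apply.
    by apply/memS; exists c.
  by rewrite comb_unit.
have FB : ProperFilter (filter_from D B).
  apply: filter_from_proper => //; apply: filter_from_filter => // S T dS dT.
  have [ST|TS] := leP (max_on S) (max_on T).
    exists S => // F [oF FS]; split=> //; split=> // c c1.
    exact: le_trans (FS c c1) ST.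
  exists T => // F [oF FT]; split=> //; split=> // c c1.
  exact: le_trans (FT c c1) (ltW TS).
have [] := orthonormal_frames_compact FB.
  by have [S dS] := D0; exists S => // F [].
move=> F [oF clF]; have [S dS memS] := subspace_of_frame oF.
exists S => // T dT; have [[v [vS v1 ->]] _] := max_onP j0 dS.
have /memS[c vc] := vS; move: v1; rewrite vc comb_unit// => c1.
(* If the value at coefficients [c] exceeded [max_on T], it would do so for all frames near [F],
   although [F] is a cluster point of [B T]. *)
rewrite leNgt; apply/negP => gt.
have gc : continuous_at F (fun F => g (comb F c)).
  apply: (@continuous_comp _ _ _ (comb ^~ c) g).
    exact: comb_continuous_frame.
  by apply: g_cont; rewrite comb_unit.
have nF : nbhs F [set F | max_on T < g (comb F c)].
  have /gc : nbhs (g (comb F c)) [set y | max_on T < y].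
    by apply: open_nbhs_nbhs; split; [exact: open_gt|].
  exact.
have BT : filter_from D B (B T) by exists T.
have [G [[oG GT] /=]] := clF _ _ BT nF.
by rewrite ltNge GT.
Qed.

(** The two hypotheses mirror the two halves of [courant_fischer]; attainment identifies [min_set]
    with the value at an optimal subspace. *)
Lemma min_max_bounds a b : (0 < j <= N)%N ->
  (forall S : {vspace 'rV[R]_N}, \dim S = j ->
     exists v, [/\ v \in S, dot v v = 1 & a <= g v]) ->
  (exists2 S : {vspace 'rV[R]_N}, \dim S = j &
     forall v, v \in S -> dot v v = 1 -> g v <= b) ->
  a <= min_set [set max_on S | S in [set S | \dim S = j]] <= b.
Proof.
move=> jN lo [T dT Tb]; have j0 : (0 < j)%N by case/andP: jN.
have [S dS Smin] := min_max_attained jN.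
have -> : min_set [set max_on S | S in [set S | \dim S = j]] = max_on S.
  by apply: min_setE => [|_ [U dU <-]]; [exists S|exact: Smin].
apply/andP; split.
  have [v [vS v1 /le_trans]] := lo S dS; apply.
  by have [_] := max_onP j0 dS; exact.
apply: le_trans (Smin T dT) _.
by have [[v [vT v1 ->]] _] := max_onP j0 dT; exact: Tb.
Qed.

End MinMax.

(** * Second-order expansion *)

Lemma continuous_at_half_sum (R : realType) (T : topologicalType)
    (a b : T -> R) (x : T) :
  continuous_at x a -> continuous_at x b ->
  continuous_at x (fun y => 2^-1 * a y + 2^-1 * b y).
Proof.
move=> ca cb; have half (c : T -> R) :
    continuous_at x c -> continuous_at x (fun y => 2^-1 * c y).
  exact: (@continuousM R T (fun=> 2^-1) c x (@cst_continuous _ _ _ _)).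
exact: (@continuousD _ _ _ _ _ x (half a ca) (half b cb)).
Qed.

(** The mean value theorem gives [f s - f 0 = df c * s] with [|c| <= |s|]. Conditions on [|t|] cover
    both signs of [s]. *)
Lemma mvt_ineq (R : realType) (f df : R -> R) (s a eta : R) :
  (forall t : R, `|t| <= `|s| -> is_derive t 1 f (df t)) ->
  (forall t, `|t| <= `|s| -> `|df t - a| <= eta) ->
  `|f s - f 0 - s * a| <= eta * `|s|.
Proof.
move=> fdf dfa.
have cf (p q : R) : (forall t, t \in `[p, q] -> `|t| <= `|s|) ->
    {within `[p, q], continuous f}.
  move=> pq; apply: derivable_within_continuous => t /pq ts.
  by have [] := fdf t ts.
have [c cs ->] : exists2 c, `|c| <= `|s| & f s - f 0 = df c * s.
  have [s0|s0] := leP 0 s.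
    have le t : t \in `[0, s] -> `|t| <= `|s|.
      by rewrite in_itv/= => /andP[t0 ts]; rewrite !ger0_norm.
    have [|c cs e] := @MVT_segment _ f df _ _ s0 _ (cf _ _ le).
      by move=> t ts; apply/fdf/le; exact: subset_itv_oo_cc ts.
    by exists c; [exact: le|rewrite e subr0].
  have le t : t \in `[s, 0] -> `|t| <= `|s|.
    by rewrite in_itv/= => /andP[ts t0]; rewrite !ler0_norm// ?lerN2// ltW.
  have [|c cs e] := @MVT_segment _ f df _ _ (ltW s0) _ (cf _ _ le).
    by move=> t ts; apply/fdf/le; exact: subset_itv_oo_cc ts.
  by exists c; [exact: le|rewrite -opprB e sub0r mulrN opprK].
have -> : df c * s - s * a = (df c - a) * s by ring.
by rewrite normrM ler_wpM2r// dfa.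
Qed.

Section Calculus.
Variables (R : realType) (N : nat).
Implicit Types (f : 'rV[R]_N -> R) (x p v h : 'rV[R]_N).

Local Notation basis i := (delta_mx 0 i : 'rV[R]_N).

Lemma is_derive_line f p v (t : R) l :
  is_derive (p + t *: v) v f l -> is_derive t 1 (fun s => f (p + s *: v)) l.
Proof.
have E : (fun r : R => r^-1 *: (((fun s => f (p + s *: v)) \o shift t) (r *: 1)
             - f (p + t *: v))) =
         (fun r : R => r^-1 *: ((f \o shift (p + t *: v)) (r *: v)
             - f (p + t *: v))).
  apply/funext => r /=; congr (_ *: (f _ - _)).
  by rewrite [_%:A]mulr1 scalerDl addrCA.
by case=> df <-; split; rewrite /derivable /derive E.
Qed.

(** Going from [x] to [x + h] one coordinate at a time, each step is a one-variable increment
    controlled by the mean value theorem and the continuity of one partial derivative. *)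
Lemma C1_expansion f x :
  (\forall y \near x, forall i, has_partial i f y) ->
  (forall i, continuous_at x (partial i f)) ->
  forall eta : R, 0 < eta -> \forall h \near (0 : 'rV[R]_N),
    `|f (x + h) - f x - \sum_i h 0 i * partial i f x| <= eta * `|h|.
Proof.
move=> fp cp eta eta0.
(* The [N] coordinate steps share the error; [N.+1] keeps the divisor nonzero even for [N = 0]. *)
pose eta' := eta / N.+1%:R.
have eta'0 : 0 < eta' by rewrite divr_gt0.
pose A i := [set y | has_partial i f y /\
                     `|partial i f y - partial i f x| <= eta'].
have : \forall y \near x, forall i, A i y.
  refine (@filter_forall _ _ A (nbhs x) _ _) => i; apply: filterI.
    by apply: filterS fp => y; exact.
  have /cvgrPdist_le/(_ _ eta'0) := cp i.
  by apply: filterS => y; rewrite distrC.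
move=> /nbhs_ballP[d /= d0 dP].
apply/nbhs_ballP; exists d => // h.
rewrite -ball_normE/= sub0r normrN => hd.
(* The path vertex at which the first [k] coordinates have been moved. *)
pose P k : 'rV[R]_N := x + \row_i (if (i < k)%N then h 0 i else 0).
have P0 : P 0%N = x.
  by rewrite /P -[RHS]addr0; congr (_ + _); apply/rowP => i; rewrite !mxE.
have PN : P N = x + h.
  by congr (_ + _); apply/rowP => i; rewrite !mxE ltn_ord.
have -> : f (x + h) - f x - \sum_i h 0 i * partial i f x =
    \sum_(k < N) (f (P k.+1) - f (P k) - h 0 k * partial k f x).
  rewrite sumrB -PN -{1}P0; congr (_ - _).
  by rewrite -(big_mkord xpredT (fun k => f (P k.+1) - f (P k))) telescope_sumr.
apply: (le_trans (ler_norm_sum _ _ _)).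
apply: (@le_trans _ _ (\sum_(k < N) eta' * `|h|)); last first.
  rewrite sumr_const card_ord -mulr_natr mulrAC ler_wpM2r//.
  rewrite /eta' mulrAC ler_pdivrMr// ler_wpM2l ?(ltW eta0)// ler_nat//.
apply: ler_sum => k _.
have PS : P k.+1 = P k + h 0 k *: basis k.
  rewrite /P -addrA; congr (_ + _); apply/rowP => i; rewrite !mxE eqxx/=.
  rewrite ltnS leq_eqVlt (inj_eq val_inj).
  by have [->|] := eqVneq i k; rewrite ?ltnn ?mulr1 ?add0r// mulr0 addr0.
have inball t : `|t| <= `|h 0 k| -> ball x d (P k + t *: basis k).
  move=> tk; rewrite -ball_normE/=; apply: le_lt_trans hd.
  rewrite distrC /P addrAC [x + _]addrC addrK.
  apply: norm_rV_le => // i; rewrite !mxE eqxx/=.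
  have [->|_] := eqVneq i k.
    by rewrite ltnn add0r mulr1 (le_trans tk)// coord_le_norm.
  by rewrite mulr0 addr0; case: ifP => _; rewrite ?normr0// coord_le_norm.
have Pk : P k = P k + 0 *: basis k by rewrite scale0r addr0.
rewrite PS {2}Pk.
apply: (@le_trans _ _ (eta' * `|h 0 k|)); last first.
  by rewrite ler_wpM2l ?coord_le_norm// ltW.
apply: (@mvt_ineq _ (fun t => f (P k + t *: basis k))
  (fun t => partial k f (P k + t *: basis k))) => t tk.
  apply: is_derive_line; apply: derivableP.
  by have /dP/(_ k)[] := inball t tk.
by have /dP/(_ k)[] := inball t tk.
Qed.

Lemma C1_is_derive f x v :
  (\forall y \near x, forall i, has_partial i f y) ->
  (forall i, continuous_at x (partial i f)) ->
  is_derive x v f (\sum_i v 0 i * partial i f x).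
Proof.
move=> fp cp; set l := \sum_i _.
have lim : (fun h : R => h^-1 *: ((f \o shift x) (h *: v) - f x)) @ 0^' --> l.
  apply/cvgrPdist_le => eta eta0.
  (* The added 1 covers [v = 0]; the error for the increment [h *: v] is then at most
     [eta * |h|]. *)
  have eta1 : 0 < eta / (`|v| + 1) by rewrite divr_gt0// ltr_wpDl.
  have /nbhs_ballP[d /= d0 dP] := C1_expansion fp cp eta1.
  near=> h.
  have h0 : h != 0 by near: h; exact: nbhs_dnbhs_neq.
  have : `|h| * (`|v| + 1) < d.
    rewrite -ltr_pdivlMr; last by rewrite ltr_wpDl.
    near: h; apply: dnbhs0_lt; rewrite divr_gt0// ltr_wpDl//.
  move=> hd.
  have hvd : ball (0 : 'rV[R]_N) d (h *: v).
    rewrite -ball_normE/= sub0r normrN normrZ; apply: le_lt_trans hd.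
    by rewrite ler_wpM2l// lerDl.
  have H : `|f (x + h *: v) - f x - h * l| <= eta * `|h|.
    have -> : h * l = \sum_i (h *: v) 0 i * partial i f x.
      by rewrite mulr_sumr; apply: eq_bigr => i _; rewrite mxE mulrA.
    apply: le_trans (dP _ hvd) _; rewrite normrZ.
    rewrite mulrCA mulrC ler_wpM2r// mulrAC ler_pdivrMr ?ltr_wpDl//.
    by rewrite ler_wpM2l ?(ltW eta0)// lerDl.
  rewrite distrC /= [h *: v + x]addrC.
  have -> : h^-1 *: (f (x + h *: v) - f x) - l =
      h^-1 * (f (x + h *: v) - f x - h * l).
    by rewrite mulrBr mulKf.
  by rewrite normrM normfV ler_pdivrMl ?normr_gt0// [leRHS]mulrC.
split; first by apply/cvg_ex; exists l.
exact: cvg_lim lim.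
Unshelve. all: by end_near. Qed.

Section SecondOrder.
Variables (Omega : set 'rV[R]_N) (f : 'rV[R]_N -> R) (x : 'rV[R]_N).
Hypotheses (oO : open Omega) (fC2 : C2_on Omega f) (Ox : Omega x).

Lemma C2_is_derive y v : Omega y ->
  is_derive y v f (\sum_i v 0 i * partial i f y).
Proof.
move=> Oy; have [_ f1 _] := fC2; apply: C1_is_derive.
  have : \forall z \near y, Omega z by exact: open_nbhs_nbhs.
  by apply: filterS => z Oz i; have [+ _] := f1 i; exact.
by move=> i; have [_] := f1 i; apply; exact/mem_set.
Qed.

(** Differentiability of the gradient at [x] in quantitative form, uniform over a sup-norm ball. *)
Definition partials_expand (eta e : R) := forall h, `|h| <= e ->
  Omega (x + h) /\ forall i,
  `|partial i f (x + h) - partial i f x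
    - \sum_k h 0 k * partial k (partial i f) x|
    <= eta * `|h|.

Lemma C2_partials_expand (eta : R) : 0 < eta ->
  exists2 d : R, 0 < d & forall e : R, e < d -> partials_expand eta e.
Proof.
move=> eta0; have [_ _ f2] := fC2.
have NO : \forall z \near x, Omega z by exact: open_nbhs_nbhs.
pose A i := [set h : 'rV[R]_N |
  `|partial i f (x + h) - partial i f x
    - \sum_k h 0 k * partial k (partial i f) x|
    <= eta * `|h|].
have : \forall h \near (0 : 'rV[R]_N), Omega (x + h) /\ forall i, A i h.
  apply: filterI.
    have /nbhs_ballP[r r0 rO] := NO; apply/nbhs_ballP; exists r => // h.
    rewrite -ball_normE/= sub0r normrN => hr; apply: rO.
    by rewrite -ball_normE/= opprD addrA subrr sub0r normrN.
  refine (@filter_forall _ _ A (nbhs (0 : 'rV[R]_N)) _ _) => i.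
  apply: C1_expansion => //.
    by apply: filterS NO => z Oz k; have [+ _] := f2 i k; exact.
  by move=> k; have [_] := f2 i k; apply; exact/mem_set.
move=> /nbhs_ballP[d /= d0 dP]; exists d => // e ed h he.
by apply: dP; rewrite -ball_normE/= sub0r normrN (le_lt_trans he).
Qed.

(** The mixed difference is the increment over [[0, s]] of [F], a difference of two parallel lines
    in direction [i]. In [dF] the pure second derivatives cancel; the errors at distances at most
    [2 * s] and [s] add up to [3 * eta * s]. *)
Lemma second_difference i k (eta s : R) : 0 <= eta -> 0 <= s ->
  partials_expand eta (2 * s) ->
  `|f (x + s *: basis k + s *: basis i) - f (x + s *: basis i)
    - f (x + s *: basis k) + f x - s ^+ 2 * partial k (partial i f) x|
    <= 3 * eta * s ^+ 2.
Proof.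
move=> eta0 s0 good.
have nb (l : 'I_N) (t : R) : `|t| <= s -> `|t *: basis l| <= s.
  move=> ts; apply: norm_rV_le => // q; rewrite !mxE eqxx/=.
  by case: eqP => _; rewrite ?mulr1// mulr0 normr0.
have sl (l : 'I_N) (t : R) (c : 'I_N -> R) :
    \sum_q (t *: basis l) 0 q * c q = t * c l.
  rewrite (bigD1 l)//= !mxE !eqxx mulr1 big1 ?addr0// => q ql.
  by rewrite !mxE (negPf ql) andbF mulr0 mul0r.
have nb2 t : `|t| <= s -> `|s *: basis k + t *: basis i| <= 2 * s.
  move=> ts; apply: (le_trans (ler_normD _ _)).
  by rewrite mulrDl mul1r lerD// nb// ger0_norm.
have nb1 t : `|t| <= s -> `|t *: basis i| <= 2 * s.
  by move=> ts; rewrite (le_trans (nb i t ts))// mulrDl mul1r lerDl.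
pose F t := f (x + s *: basis k + t *: basis i) - f (x + t *: basis i).
pose dF t := partial i f (x + s *: basis k + t *: basis i)
             - partial i f (x + t *: basis i).
have dbi y : Omega y -> is_derive y (basis i) f (partial i f y).
  by move=> Oy; apply: derivableP; have [_ /(_ i)[+ _] _] := fC2; exact.
have := @mvt_ineq _ F dF s (s * partial k (partial i f) x) (3 * eta * s).
rewrite (ger0_norm s0) /F !scale0r !addr0 => H.
rewrite (_ : _ - s ^+ 2 * _ = f (x + s *: basis k + s *: basis i)
  - f (x + s *: basis i) - (f (x + s *: basis k) - f x)
  - s * (s * partial k (partial i f) x)); last by ring.
rewrite [leRHS](_ : _ = 3 * eta * s * s); last by ring.
apply: H => t ts.
  apply: is_deriveB; apply: is_derive_line; apply: dbi.
    by rewrite -addrA; have [] := good _ (nb2 t ts).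
  by have [] := good _ (nb1 t ts).
have [_ /(_ i) A] := good _ (nb1 t ts).
have [_ /(_ i) B] := good _ (nb2 t ts).
have sB : \sum_q (s *: basis k + t *: basis i) 0 q * partial q (partial i f) x
    = s * partial k (partial i f) x + t * partial i (partial i f) x.
  rewrite -(sl k s (fun q => partial q (partial i f) x)).
  rewrite -(sl i t (fun q => partial q (partial i f) x)) -big_split.
  by apply: eq_bigr => q _; rewrite mxE mulrDl.
rewrite sl in A; rewrite sB addrA in B; rewrite /dF.
have {}A := le_trans A (ler_wpM2l eta0 (nb i t ts)).
have {}B := le_trans B (ler_wpM2l eta0 (nb2 t ts)).
move: (partial i f (x + s *: basis k + _)) (partial i f (x + t *: _)) A B.
move: (partial i f x) (s * partial k _ x) (t * partial i _ x); clear.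
move=> p c q a1 a2; rewrite !ler_norml => /andP[A1 A2] /andP[B1 B2].
by apply/andP; split; lra.
Qed.

(** The second difference is symmetric in [i] and [k], so it approximates both mixed derivatives. *)
Lemma clairaut i k : partial k (partial i f) x = partial i (partial k f) x.
Proof.
apply/eqP; rewrite -subr_eq0 -normr_eq0 eq_le normr_ge0 andbT.
apply/ler_addgt0Pr => eta eta0; rewrite add0r.
(* Two estimates, each with constant 3, give the 6; below, [s = d / 3] ensures [2 * s < d]. *)
have eta6 : 0 < eta / 6 by rewrite divr_gt0.
have [d d0 good] := C2_partials_expand eta6.
pose s := d / 3.
have s0 : 0 < s by rewrite divr_gt0.
have gs : partials_expand (eta / 6) (2 * s) by apply: good; rewrite /s; lra.
have A := second_difference i k (ltW eta6) (ltW s0) gs.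
have B := second_difference k i (ltW eta6) (ltW s0) gs.
have s2 : 0 < s ^+ 2 by rewrite exprn_gt0.
rewrite -(ler_pM2l s2) -{1}(gtr0_norm s2) -normrM.
move: A B; rewrite [x + s *: basis i + _]addrAC.
move: (f (x + _ + _)) (f (x + _)) (f (x + _)) (f x) => Q a b z.
move: (partial k _ x) (partial i _ x) (s ^+ 2); clear=> c c' w.
rewrite !ler_norml mulrBr => /andP[A1 A2] /andP[B1 B2].
by apply/andP; split; lra.
Qed.

Lemma hessian_sym : (hessian f x)^T = hessian f x.
Proof. by apply/matrixP => i k; rewrite !mxE clairaut. Qed.

(** The even function [k] of [t] has its quadratic term removed, so expanding the gradient at [x]
    bounds [dk] by [2 * eta * e]. The mean value theorem and division by 2 finish; [d] does not
    depend on [v]. *)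
Lemma symmetric_taylor (eta : R) : 0 < eta ->
  exists2 d : R, 0 < d & forall (e : R) v,
  0 < e < d -> dot v v = 1 -> [/\ Omega (x + e *: v), Omega (x - e *: v) &
  `|mean_sym f x e v - f x - e ^+ 2 / 2 * dot (v *m hessian f x) v|
    <= eta * e ^+ 2].
Proof.
move=> eta0; pose eta' := eta / N.+1%:R.
have eta'0 : 0 < eta' by rewrite divr_gt0.
have [d d0 good] := C2_partials_expand eta'0; exists d => // e v /andP[e0 ed] v1.
have {ed}/good ge := ed.
have nv : `|v| <= 1 by apply: norm_rV_le => // i; exact: unit_coord_le1.
have nt t : `|t| <= e -> `|t *: v| <= e.
  by move=> te; rewrite normrZ -[leRHS]mulr1 ler_pM.
have ntN t : `|t| <= e -> `|t *: - v| <= e.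
  by move=> te; rewrite scalerN normrN nt.
have Oq t : `|t| <= e -> Omega (x + t *: v) /\ Omega (x + t *: - v).
  by move=> te; have [? _] := ge _ (nt t te); have [? _] := ge _ (ntN t te).
have ee : `|e| <= e by rewrite gtr0_norm.
have [Op On] := Oq e ee; split=> //; first by rewrite -scalerN.
set q := dot _ _.
have qE : q = \sum_i v 0 i * \sum_k v 0 k * partial k (partial i f) x.
  rewrite /q dotE; apply: eq_bigr => i _; rewrite mulrC mxE.
  by congr (_ * _); apply: eq_bigr => k _; rewrite mxE.
pose k t := f (x + t *: v) + f (x + t *: - v) - t ^+ 2 * q.
pose dk t := \sum_i v 0 i * partial i f (x + t *: v)
  + \sum_i (- v) 0 i * partial i f (x + t *: - v) - (2 * t) * q.
have kdk (t : R) : `|t| <= `|e| -> is_derive t 1 k (dk t).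
  rewrite (gtr0_norm e0) => /Oq[Ot Ot'].
  apply: is_deriveB; first by apply: is_deriveD; apply: is_derive_line;
    exact: C2_is_derive.
  have -> : (fun s : R => s ^+ 2 * q) = cst q * (id * id).
    by apply/funext => s; rewrite expr2 mulrC.
  apply: is_derive_eq.
  rewrite scaler0 addr0 -scalerDr /= -[LHS]/(q * (t * (1 + 1))).
  by rewrite mulrC [t * _]mulrC.
have dk0 (t : R) : `|t| <= `|e| -> `|dk t - 0| <= 2 * (eta * e).
  rewrite (gtr0_norm e0) subr0 => te.
  rewrite /dk qE mulr_sumr -big_split -sumrB/=.
  apply: (le_trans (ler_norm_sum _ _ _)).
  (* Each coordinate contributes two gradient errors of size [eta' * e], weighted by [v 0 i], whose
     absolute value is at most 1. *)
  apply: (@le_trans _ _ (\sum_(i < N) 2 * (eta' * e))); last first.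
    rewrite sumr_const card_ord -[leLHS]mulr_natr -mulrA ler_wpM2l//.
    rewrite mulrAC ler_wpM2r ?(ltW e0)// /eta' mulrAC ler_pdivrMr//.
    by rewrite ler_wpM2l ?(ltW eta0)// ler_nat.
  apply: ler_sum => i _; rewrite mxE.
  have [_ /(_ i) A] := ge _ (nt t te).
  have [_ /(_ i) B] := ge _ (ntN t te).
  have {}A := le_trans A (ler_wpM2l (ltW eta'0) (nt t te)).
  have {}B := le_trans B (ler_wpM2l (ltW eta'0) (ntN t te)).
  have sv (w : 'rV[R]_N) (c : R) :
      \sum_k (c *: w) 0 k * partial k (partial i f) x =
      c * \sum_k w 0 k * partial k (partial i f) x.
    by rewrite mulr_sumr; apply: eq_bigr => l _; rewrite mxE mulrA.
  rewrite scalerN -scaleNr !sv in A B *.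
  move: (\sum_k _) (partial i f (x + t *: v)) (partial i f (x + - t *: v)) A B.
  move: (partial i f x) (unit_coord_le1 i v1); clear=> p vi1 S p1 p2 A B.
  have -> : v 0 i * p1 + - v 0 i * p2 - 2 * t * (v 0 i * S) =
      v 0 i * (p1 - p2 - 2 * t * S) by ring.
  rewrite normrM; apply: (@le_trans _ _ `|p1 - p2 - 2 * t * S|).
    by rewrite ler_piMl.
  move: A B; clear; rewrite !ler_norml => /andP[A1 A2] /andP[B1 B2].
  by apply/andP; split; lra.
have := mvt_ineq kdk dk0.
rewrite /k (gtr0_norm e0) !scale0r !addr0 scalerN expr0n/=
  mul0r subr0 mulr0 subr0.
rewrite /mean_sym; move: (f (x + _)) (f (x - _)) (f x) => a b c.
clearbody q; clear.
rewrite !ler_norml => /andP[A1 A2].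
by apply/andP; split; lra.
Qed.

(** The Taylor error is uniform over unit vectors, so the two Courant-Fischer bounds carry over from
    the quadratic form to [mean_sym]. *)
Lemma minmax_mean_expansion j (eta : R) : (1 <= j <= N)%N -> 0 < eta ->
  exists2 d : R, 0 < d & forall e : R, 0 < e < d ->
  `|minmax_mean j f x e - f x - e ^+ 2 / 2 * lambda j (hessian f x)|
    <= eta * e ^+ 2.
Proof.
move=> jN eta0; have [d d0 taylor] := symmetric_taylor eta0; exists d => // e ed.
have [[S [dS upS]] lo] := courant_fischer hessian_sym jN.
have e2 : 0 <= e ^+ 2 / 2 by rewrite divr_ge0 ?sqr_ge0.
(* Continuity of [f] is known only on [Omega]; for unit [v] both [x + e *: v] and [x - e *: v] lie
   there. *)
have g_cont v : dot v v = 1 -> continuous_at v (mean_sym f x e).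
  move=> v1; have [Op Om _] := taylor e v ed v1.
  have [f0 _ _] := fC2.
  have cline (s : R) : Omega (x + s *: v) ->
      continuous_at v (fun w => f (x + s *: w)).
    move=> Os.
    have := @continuous_comp _ _ _ (fun w : 'rV[R]_N => x + s *: w) f v; apply.
      apply: continuousD; first exact: cst_continuous.
      exact: scaler_continuous.
    by apply: f0; exact/mem_set.
  have Cp := cline e Op; have Cm := cline (- e).
  rewrite scaleNr in Cm; have {}Cm := Cm Om.
  have -> : mean_sym f x e = fun w =>
      2^-1 * f (x + e *: w) + 2^-1 * f (x + (- e) *: w).
    by apply/funext => w; rewrite /mean_sym scaleNr.
  exact: continuous_at_half_sum Cp Cm.
move: (lambda _ _) upS lo => l upS lo.
have : f x + e ^+ 2 / 2 * l - eta * e ^+ 2 <= minmax_mean j f x e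
    <= f x + e ^+ 2 / 2 * l + eta * e ^+ 2.
  apply: (min_max_bounds g_cont) => // [T dT|].
    have [v [vT v1 lv]] := lo T dT; exists v; split=> //.
    have [_ _] := taylor e v ed v1; have := ler_wpM2l e2 lv.
    move: (mean_sym _ _ _ _) (dot _ _) (f x); clear=> m q z.
    by rewrite ler_norml => A /andP[B C]; lra.
  exists S => // v vS v1.
  have [_ _] := taylor e v ed v1; have := ler_wpM2l e2 (upS v vS v1).
  move: (mean_sym _ _ _ _) (dot _ _) (f x); clear=> m q z.
  by rewrite ler_norml => A /andP[B C]; lra.
move: (minmax_mean _ _ _ _) (f x); clear=> m z.
by rewrite ler_norml => /andP[A B]; apply/andP; split; lra.
Qed.


End SecondOrder.
End Calculus.

(** * From the uniform expansion to the sign of the second-order coefficient *)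

Section LittleO.
Variables (R : realType) (m : R -> R) (p l : R).
Hypothesis m_exp : forall eta : R, 0 < eta -> exists2 d : R, 0 < d &
  forall e : R, 0 < e < d -> `|m e - p - e ^+ 2 / 2 * l| <= eta * e ^+ 2.

Lemma expansion_le0 :
  (exists2 r : R -> R, r =o_ (0^'+) (fun e : R => e ^+ 2)
     & \forall e \near 0^'+, 0 >= - p + m e + r e) <-> l <= 0.
Proof.
split=> [[r /eqoP ro rle]|l0]; last first.
  (* Cancelling the remainder exactly leaves [e ^+ 2 / 2 * l], which is nonpositive. *)
  exists (fun e => - (m e - p - e ^+ 2 / 2 * l)).
    apply/eqoP => eta eta0; have [d d0 dP] := m_exp eta0.
    near=> e; rewrite normrN [X in _ <= _ * X]ger0_norm ?sqr_ge0//.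
    apply: dP; apply/andP; split; near: e.
      exact: nbhs_right_gt.
    exact: nbhs_right_lt.
  near=> e; have : e ^+ 2 / 2 * l <= 0.
    by rewrite mulr_ge0_le0// divr_ge0 ?sqr_ge0.
  by lra.
rewrite leNgt; apply/negP => l0.
(* The remainder and [r e] are each at most [l / 8 * e ^+ 2] in absolute value, too small to offset
   [l / 2 * e ^+ 2]. *)
have l8 : 0 < l / 8 by rewrite divr_gt0.
have [d d0 dP] := m_exp l8.
suff : \forall e \near (0:R)^'+, False by move=> /filter_ex[].
near=> e.
have e0 : 0 < e by near: e; exact: nbhs_right_gt.
have ed : e < d by near: e; exact: nbhs_right_lt.
have re : - p + m e + r e <= 0 by near: e.
have : `|r e| <= l / 8 * `|e ^+ 2| by near: e; exact: ro.
have e2 : 0 < e ^+ 2 by rewrite exprn_gt0.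
have el : 0 < e ^+ 2 * l by rewrite mulr_gt0.
rewrite (gtr0_norm e2); have := dP e; rewrite e0 ed => /(_ isT).
by rewrite !ler_norml => /andP[A B] /andP[C D]; lra.
Unshelve. all: by end_near. Qed.

End LittleO.

(** Negating [m], [p], [l] and the error term [r] reduces this to [expansion_le0]. *)
Lemma expansion_ge0 (R : realType) (m : R -> R) (p l : R) :
  (forall eta : R, 0 < eta -> exists2 d : R, 0 < d &
    forall e : R, 0 < e < d -> `|m e - p - e ^+ 2 / 2 * l| <= eta * e ^+ 2) ->
  (exists2 r : R -> R, r =o_ (0^'+) (fun e : R => e ^+ 2)
     & \forall e \near 0^'+, 0 <= - p + m e + r e) <-> 0 <= l.
Proof.
move=> m_exp; rewrite -oppr_le0.
have /expansion_le0 <- : forall eta : R, 0 < eta -> exists2 d : R, 0 < d &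
    forall e : R, 0 < e < d ->
    `|(- m) e - (- p) - e ^+ 2 / 2 * (- l)| <= eta * e ^+ 2.
  move=> eta /m_exp[d d0 dP]; exists d => // e /dP.
  by rewrite -normrN mulrN opprK !opprD !opprK.
split=> -[r /eqoP ro rle]; exists (- r).
- by apply/eqoP => eta /ro; apply: filterS => e; rewrite normrN.
- by apply: filterS rle => e; rewrite -oppr_ge0 !opprD !opprK.
- by apply/eqoP => eta /ro; apply: filterS => e; rewrite normrN.
- by apply: filterS rle => e; rewrite -oppr_ge0 !opprD !opprK.
Qed.

Theorem theorem5 (R : realType) (N j : nat) (Omega : set 'rV[R]_N)
    (u : 'rV[R]_N -> R) (Omega_domain : domain Omega)
    (u_cont : {within Omega, continuous u}) (j_range : (1 <= j <= N)%N) :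
  asymptotic_expansion_viscosity j Omega u <->
  lambda_equation_viscosity j Omega u.
Proof.
have [oO _ _] := Omega_domain.
have expansion f x : C2_on Omega f -> Omega x -> forall eta : R, 0 < eta ->
    exists2 d : R, 0 < d & forall e : R, 0 < e < d ->
    `|minmax_mean j f x e - f x - e ^+ 2 / 2 * lambda j (hessian f x)|
      <= eta * e ^+ 2.
  by move=> fC2 Ox eta; exact (minmax_mean_expansion oO fC2 Ox j_range).
(* The equivalence holds separately for each test function at its contact point. *)
split=> -[below above]; split=> f x fC2 touch;
  have [Ox _ _] := touch; have f_exp := expansion f x fC2 Ox.
- by apply/(expansion_le0 f_exp); exact: below.
- by apply/(expansion_ge0 f_exp); exact: above.
- by apply/(expansion_le0 f_exp); exact: below.
- by apply/(expansion_ge0 f_exp); exact: above.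
Qed.
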